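(* For any positive integer $m$, the normalized volume of the partial permutohedron $\mathcal{P}(m,4)$ is $$v(m,4)=10^m-m\,6^m-\frac{m(m-1)(m-3)}{6}\,3^m-(3m^2-6m+1)\binom{m}{3}.$$
   Context: For positive integers $m,n$, the partial permutohedron $\mathcal{P}(m,n)\subseteq\mathbb{R}^m$ is the convex hull of all vectors in $\{0,1,\ldots,n\}^m$ whose nonzero entries are distinct. Its normalized volume is $v(m,n)=m!\cdot\mathrm{Vol}(\mathcal{P}(m,n))$, with $\mathrm{Vol}$ Lebesgue measure on $\mathbb{R}^m$. *)

(* Defs.v *)
From HB Require Import structures.
From mathcomp Require Import all_boot all_order all_algebra.
From mathcomp Require Import all_classical all_reals all_analysis.

Set Implicit Arguments.
Unset Strict Implicit.
Unset Printing Implicit Defensive.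
Import Order.TTheory GRing.Theory Num.Theory.
Import numFieldNormedType.Exports.

Local Open Scope classical_set_scope.
Local Open Scope ring_scope.

Section lebesgue_tuple.
Context {R : realType}.

Definition tcons n (p : R * n.-tuple R) : n.+1.-tuple R :=
  [tuple of p.1 :: p.2].

(* Lebesgue measure on R^n, as the n-fold product of lebesgue_measure. It is a
   sigma-finite measure on n.-tuple R (HB instances below) with the expected
   value on boxes (lebesgue_tuple_box). *)
Fixpoint lebesgue_tuple n : set (n.-tuple R) -> \bar R :=
  match n with
  | 0 => fun A => dirac [tuple] A
  | n'.+1 => pushforward (lebesgue_measure \x @lebesgue_tuple n')%E (@tcons n')
  end.

Lemma measurable_tcons n : measurable_fun setT (@tcons n).
Proof. exact: measurable_cons. Qed.

Let uncons n (t : n.+1.-tuple R) : R * n.-tuple R :=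
  (thead t, [tuple of behead t]).

Let tconsK n : cancel (@tcons n) (@uncons n).
Proof.
by move=> [x t]; rewrite /uncons theadE; congr pair; exact/val_inj.
Qed.

Let measurable_uncons n : measurable_fun setT (@uncons n).
Proof.
apply: measurable_fun_pair; first exact: measurable_tnth.
exact: measurable_behead.
Qed.

Section step.
Variables (n : nat) (m : {sigma_finite_measure set (n.-tuple R) -> \bar R}).

(* product_measure1 is only inferred to be sigma-finite for subprobabilities,
   so sigma-finiteness of the product with m is proved directly. *)
Let step : set (n.+1.-tuple R) -> \bar R :=
  pushforward (lebesgue_measure \x m)%E (@tcons n).

HB.instance Definition _ := Measure.copy step
  (measure_function_pushforward__canonical__measure_function_Measure
    (lebesgue_measure \x m)%E (@measurable_tcons n)).

Let step_sigma_finite : sigma_finite setT step.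
Proof.
have /sigma_finiteP[F [TF ndF Foo]] := sigma_finiteT (@lebesgue_measure R).
have /sigma_finiteP[G [TG ndG Goo]] := sigma_finiteT m.
exists (fun k => @uncons n @^-1` (F k `*` G k)).
  rewrite -preimage_bigcup -(preimage_setT (@uncons n)); congr (_ @^-1` _).
  apply/esym/seteqP; split => // -[x t] _.
  have [i _ Fx] : (\bigcup_k F k) x by rewrite -TF.
  have [j _ Gt] : (\bigcup_k G k) t by rewrite -TG.
  exists (maxn i j) => //; split => /=.
    by move: x Fx; exact/subsetPset/ndF/leq_maxl.
  by move: t Gt; exact/subsetPset/ndG/leq_maxr.
move=> k; have [mF Fk] := Foo k; have [mG Gk] := Goo k; split.
  rewrite -[X in measurable X]setTI; apply: measurable_uncons => //.
  exact: measurableX.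
rewrite /step /pushforward -comp_preimage.
rewrite (_ : _ \o _ = id); last by apply/funext => x; exact: tconsK.
by rewrite preimage_id product_measure1E// lte_mul_pinfty// ge0_fin_numE.
Qed.

HB.instance Definition _ :=
  Measure_isSigmaFinite.Build _ _ _ step step_sigma_finite.

Definition lebesgue_step : {sigma_finite_measure set (n.+1.-tuple R) -> \bar R}
  := step.

End step.

Let lebesgue_tuple_is_measure n :
  exists mu : {sigma_finite_measure set (n.-tuple R) -> \bar R},
    mu = @lebesgue_tuple n :> (set (n.-tuple R) -> \bar R).
Proof.
elim: n => [|n [m mE]].
  by exists (dirac [tuple]).
by exists (lebesgue_step m); rewrite /= -mE.
Qed.

Let lebesgue_tuple0 n : @lebesgue_tuple n set0 = 0%E.
Proof. by have [mu <-] := lebesgue_tuple_is_measure n; exact: measure0. Qed.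

Let lebesgue_tuple_ge0 n A : (0 <= @lebesgue_tuple n A)%E.
Proof. by have [mu <-] := lebesgue_tuple_is_measure n; exact: measure_ge0. Qed.

Let lebesgue_tuple_sigma_additive n : semi_sigma_additive (@lebesgue_tuple n).
Proof.
have [mu <-] := lebesgue_tuple_is_measure n.
exact: measure_semi_sigma_additive.
Qed.

HB.instance Definition _ n := isMeasure.Build _ _ _ (@lebesgue_tuple n)
  (lebesgue_tuple0 n) (@lebesgue_tuple_ge0 n)
  (@lebesgue_tuple_sigma_additive n).

Let lebesgue_tuple_sigma_finite n : sigma_finite setT (@lebesgue_tuple n).
Proof.
by have [mu <-] := lebesgue_tuple_is_measure n; exact: sigma_finiteT.
Qed.

HB.instance Definition _ n := Measure_isSigmaFinite.Build _ _ _
  (@lebesgue_tuple n) (lebesgue_tuple_sigma_finite n).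

Lemma measurable_box n (a b : n.-tuple R) :
  measurable [set t | forall i, tnth a i <= tnth t i <= tnth b i].
Proof.
rewrite (_ : [set _ | _] =
  \bigcap_(i in [set: 'I_n]) ((@tnth _ R)^~ i @^-1` `[tnth a i, tnth b i])).
  apply: fin_bigcap_measurable => // i _.
  by rewrite -[X in measurable X]setTI; exact: measurable_tnth.
by apply/seteqP; split=> [t H i _|t H i]; have := H i;
  rewrite /= in_itv => // /(_ I).
Qed.

Lemma lebesgue_tuple_box n (a b : n.-tuple R) :
    (forall i, tnth a i <= tnth b i) ->
  lebesgue_tuple [set t | forall i, tnth a i <= tnth t i <= tnth b i] =
  (\prod_(i < n) (tnth b i - tnth a i))%:E.
Proof.
elim: n a b => [|n IH] a b.
  by rewrite /= big_ord0 diracE mem_set// => -[].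
case/tupleP: a => a0 a; case/tupleP: b => b0 b ab.
rewrite /= /pushforward.
have -> : @tcons n @^-1` [set t | forall i, tnth [tuple of a0 :: a] i <=
      tnth t i <= tnth [tuple of b0 :: b] i] =
    `[a0, b0] `*` [set t | forall i, tnth a i <= tnth t i <= tnth b i].
  apply/seteqP; split => [[x t]/= H|[x t] /= [H0 H1] i].
    split; first by have := H ord0; rewrite !tnth0 in_itv.
    by move=> i; have := H (lift ord0 i); rewrite !tnthS.
  case: (unliftP ord0 i) => [j|] ->; rewrite ?tnth0 ?tnthS//.
rewrite product_measure1E//; last exact: measurable_box.
rewrite /= IH; last by move=> i; have := ab (lift ord0 i); rewrite !tnthS.
have ab0 : a0 <= b0 by have := ab ord0; rewrite !tnth0.
rewrite lebesgue_measure_itv/= lte_fin big_ord_recl !tnth0.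
under [in RHS]eq_bigr do rewrite !tnthS.
rewrite EFinM; congr (_ * _)%E.
by move: ab0; rewrite le_eqVlt => /predU1P[->|->]//; rewrite ltxx subrr.
Qed.

End lebesgue_tuple.

Definition volume (R : realType) m (A : set 'rV[R]_m) : \bar R :=
  lebesgue_tuple [set t : m.-tuple R | A (\row_i tnth t i)].

Definition conv_hull (R : realType) (M : lmodType R) (A : set M) : set M :=
  smallest (@convex_set R M) A.

Definition partial_perm_vectors (R : realType) m n : set 'rV[R]_m :=
  [set x | (forall i, exists2 k, (k <= n)%N & x 0 i = k%:R) /\
           (forall i j, i != j -> x 0 i != 0 -> x 0 j != 0 -> x 0 i != x 0 j)].
Arguments partial_perm_vectors : clear implicits.

Definition partial_permutohedron (R : realType) m n : set 'rV[R]_m :=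
  conv_hull (partial_perm_vectors R m n).
Arguments partial_permutohedron : clear implicits.

Definition normalized_volume (R : realType) m n : \bar R :=
  ((m`!)%:R%:E * volume (partial_permutohedron R m n))%E.

(* Main.v *)
Require Import Defs.
From mathcomp Require Import all_boot all_order all_algebra.
From mathcomp Require Import all_classical all_reals all_analysis.
From mathcomp Require Import measurable_realfun perm zify ring lra.

Set Implicit Arguments.
Unset Strict Implicit.
Unset Printing Implicit Defensive.
Import Order.TTheory GRing.Theory Num.Theory.
Import numFieldNormedType.Exports.

Local Open Scope classical_set_scope.
Local Open Scope ring_scope.

(** The polytope is a polymatroid. Its defining inequalities say that x >= 0
    and that every k coordinates have sum at most n + (n-1) + ... (k terms),
    see [partial_permutohedronE]. Points of the hull satisfy them because the
    generating vectors do. Conversely, sort the coordinates of a point of the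
    polymatroid decreasingly; it is then weakly majorized by the staircase
    (n, n-1, ...), and Muirhead's argument ([dominated_mem]) transforms the
    staircase into the point by averaging over transpositions and by shrinking
    coordinates, two operations under which the hull is stable.

    For n = 4 the polymatroid is the simplex Delta (x >= 0, sum at most 10)
    cut by the inequalities x_i <= 4, x_i + x_j <= 7 and
    x_i + x_j + x_k <= 9. Few of them can fail simultaneously, since a point of
    Delta has a total budget of 10: at most two coordinates exceed 4, and if
    none does, then at most one pair exceeds 7, at most one triple exceeds 9,
    and an excessive pair lies inside an excessive triple if both exist. This
    yields an exact inclusion-exclusion of indicator functions
    ([decomposition]):
      Delta + (two coordinates > 4) + (excessive triple containing an
      excessive pair)
      = P + (one coordinate > 4) + (excessive pair) + (excessive triple).
    Each region other than P restricts only k <= 3 coordinates besides the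
    condition of being in Delta. Lebesgue measure is
    invariant under permuting coordinates ([lebesgue_tuple_perm]), so these
    may be taken to be the first k ones; the remaining coordinates then range
    over a simplex, whose volume is c^d / d! ([volume_simplex]), and the first
    k coordinates are integrated out by Fubini. With

      s_d(c) = c^d / d! for c >= 0 and 0 otherwise,

    every such integral is elementary because an antiderivative of
    x |-> s_d(c - x) is - s_(d+1)(c - x), including across the kink at c. The
    volumes are s_m(6) and s_m(2) for one and two large coordinates,
    s_(m-1)(3) - s_m(3) + s_m(2) for a pair,
    9/2 s_(m-2)(1) - 3 s_(m-1)(1) + s_m(1) for a triple, and
    1/2 s_(m-2)(1) for a triple containing a given excessive pair. Summing
    over the binomially many choices of coordinates gives the formula. *)

(** * The partial permutohedron as a polymatroid *)

Section hull.
Context {R : realType}.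

(** The polymatroid rank function of the staircase (n, n-1, ..., 1, 0, 0, ...);
    the truncated subtraction provides the zeros. *)
Definition cap n k : nat := (\sum_(j < k) (n - j))%N.

Definition polymatroid m n : set 'rV[R]_m :=
  [set x | (forall i, 0 <= x 0 i) /\
    forall J : {set 'I_m}, \sum_(i in J) x 0 i <= (cap n #|J|)%:R].

Definition segment_closed (M : lmodType R) (A : set M) :=
  forall (t : R) x y, 0 <= t <= 1 -> A x -> A y -> A (t *: x + (1 - t) *: y).

Lemma convex_setP (M : lmodType R) (A : set M) :
  @convex_set R M A <-> segment_closed A.
Proof.
split=> [cA t x y /andP[t0 t1] Ax Ay|cA x y l /set_mem Ax /set_mem Ay].
- have t01 : 0 <= t <= 1 by rewrite t0 t1.
  have := @cA x y (Itv01 t0 t1) (mem_set Ax) (mem_set Ay).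
  by rewrite inE.
- rewrite inE; apply: cA => //.
  by apply/andP; split.
Qed.

Lemma polymatroid_segment_closed m n : segment_closed (@polymatroid m n).
Proof.
move=> t x y /andP[t0 t1] [x0 xJ] [y0 yJ]; have t1' : 0 <= 1 - t by lra.
split=> [i|J]; first by rewrite !mxE; apply: addr_ge0; exact: mulr_ge0.
under eq_bigr do rewrite !mxE.
rewrite big_split/= -!mulr_sumr.
have := ler_wpM2l t0 (xJ J); have := ler_wpM2l t1' (yJ J); lra.
Qed.

(** Induction on n: the value n is taken at most once, and removing that index
    removes the first term of the staircase. *)
Lemma sum_distinct_le_cap (I : finType) n (k : I -> nat) (J : {set I}) :
  {in J, forall i, k i <= n}%N ->
  {in J &, forall i j, i != j -> k i != 0%N -> k j != 0%N -> k i != k j} ->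
  (\sum_(i in J) k i <= cap n #|J|)%N.
Proof.
elim: n J => [|n IH] J kn kinj.
  by rewrite big1// => i /kn; rewrite leqn0 => /eqP.
have [/existsP[i /andP[iJ /eqP ki]]|/existsPn Nn] :=
  boolP [exists i, (i \in J) && (k i == n.+1)].
- rewrite (big_setD1 i iJ) /= ki (cardsD1 i J) iJ /cap big_ord_recl subn0.
  rewrite leq_add2l; apply: IH => [j|j l].
  + rewrite !inE => /andP[ji jJ]; rewrite -ltnS ltn_neqAle kn// andbT -ki.
    have [->|kj0] := eqVneq (k j) 0%N; first by rewrite ki.
    by apply: kinj => //; rewrite ki.
  + by rewrite !inE => /andP[_ jJ] /andP[_ lJ]; exact: kinj.
- have kn' : {in J, forall i, k i <= n}%N.
    move=> i iJ; have := Nn i; rewrite iJ /= => kin.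
    by rewrite -ltnS ltn_neqAle kin kn.
  apply: leq_trans (IH J kn' kinj) _.
  by apply: leq_sum => j _; exact/leq_sub2r/leqnSn.
Qed.

Lemma partial_perm_vectors_sub m n :
  partial_perm_vectors R m n `<=` @polymatroid m n.
Proof.
move=> x [xn xinj].
have {xn} xk i : exists k, (k <= n)%N /\ x 0 i = k%:R.
  by have [k kn xi] := xn i; exists k.
pose k i := projT1 (cid (xk i)).
have kn i : (k i <= n)%N by rewrite /k; case: cid => ? [].
have xE i : x 0 i = (k i)%:R by rewrite /k; case: cid => ? [].
split=> [i|J]; first by rewrite xE.
under eq_bigr do rewrite xE.
rewrite -natr_sum ler_nat; apply: sum_distinct_le_cap => // i j _ _ ij ki kj.
by have := xinj i j ij; rewrite !xE !pnatr_eq0 eqr_nat; apply.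
Qed.

(** The Hardy-Littlewood-Polya proof of majorization, in a form that asks only
    x to be sorted: each step replaces y by a point of H that agrees with x in
    one more coordinate and keeps the prefix sums dominating those of x. If y >= x
    everywhere, one coordinate of y is shrunk. Otherwise let k be the
    first coordinate with x_k > y_k; prefix domination provides j < k with slack
    y_j > x_j, and some mass is moved from j to k. As
    y_j > x_j >= x_k > y_k, this mass is at most y_j - y_k, so the new point is
    an average of y and of y with its coordinates j and k exchanged. *)
Lemma dominated_mem m (H : set 'rV[R]_m) :
  segment_closed H ->
  (forall s x, H x -> H (col_perm s x)) ->
  (forall i x, H x -> H (\row_j if j == i then 0 else x 0 j)) ->
  forall x y : 'rV[R]_m, (forall i, 0 <= x 0 i) ->
  (forall i j : 'I_m, (i <= j)%N -> x 0 j <= x 0 i) ->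
  (forall k, \sum_(i < m | (i < k)%N) x 0 i <= \sum_(i < m | (i < k)%N) y 0 i) ->
  H y -> H x.
Proof.
move=> cH pH zH x y x0 xdec.
have [d] := ubnP #|[pred i | x 0 i != y 0 i]|; elim: d y => // d IH y yd xy Hy.
have step (y' : 'rV[R]_m) (i : 'I_m) :
    (forall j : 'I_m, x 0 j = y 0 j -> y' 0 j = y 0 j) ->
    x 0 i != y 0 i -> y' 0 i = x 0 i ->
    (#|[pred j | (x 0 j != y' 0 j)%R]| < d)%N.
  move=> yy' xi y'i; rewrite -ltnS; apply: leq_trans yd; rewrite ltnS.
  apply: proper_card; apply/properP; split.
    apply/fintype.subsetP => j; rewrite !inE; apply: contra => /eqP xyj.
    by rewrite (yy' _ xyj) xyj.
  by exists i; rewrite !inE ?xi// y'i eqxx.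
have [/existsP[k0 yxk0]|] := boolP [exists i, y 0 i < x 0 i]; last first.
  move=> /existsPn xley.
  have {}xley i : x 0 i <= y 0 i by have := xley i; rewrite -leNgt.
  have [/existsP[i xyi]|/existsPn xE] := boolP [exists i, x 0 i != y 0 i]; last first.
    suff -> : x = y by [].
    by apply/rowP => i; apply/eqP; have := xE i; rewrite negbK.
  have xyi' : x 0 i < y 0 i by rewrite lt_neqAle xyi xley.
  have yi0 : 0 < y 0 i by exact: le_lt_trans (x0 i) _.
  pose y' : 'rV[R]_m := \row_j if j == i then x 0 i else y 0 j.
  have y'E j : y' 0 j = if j == i then x 0 i else y 0 j by rewrite mxE.
  apply: (IH y').
  - apply: (@step _ i) => //; last by rewrite y'E eqxx.
    by move=> j xyj; rewrite y'E; case: eqVneq xyj => // -> ->.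
  - by move=> k; apply: ler_sum => j _; rewrite y'E; case: eqVneq => [->|].
  - pose t := x 0 i / y 0 i.
    have -> : y' = t *: y + (1 - t) *: (\row_j if j == i then 0 else y 0 j).
      apply/rowP => j; rewrite !mxE; case: eqVneq => [->|_]; last by ring.
      by rewrite mulr0 addr0 /t divfK// gt_eqF.
    apply: cH => //; last exact: zH.
    rewrite /t divr_ge0//=; last exact: ltW.
    by rewrite ler_pdivrMr// mul1r.
(* without slack before k, the prefix sums up to k included would contradict
   the domination *)
case: (@arg_minnP _ k0 (fun i => y 0 i < x 0 i) val yxk0) => k yxk kmin.
have [/existsP[j /andP[jk xyj]]|/existsPn Nj] :=
    boolP [exists j : 'I_m, (j < k)%N && (x 0 j < y 0 j)]; last first.
  have := xy k.+1; rewrite leNgt => /negP; case.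
  rewrite (bigD1 k)//= [ltRHS](bigD1 k)//=; apply: ltr_leD => //.
  apply: ler_sum => i; rewrite ltnS => /andP[ik iNk].
  have {}ik : (i < k)%N by rewrite ltn_neqAle ik andbT.
  by have := Nj i; rewrite ik /= -leNgt.
(* the largest transfer that overshoots neither coordinate: it makes y agree
   with x at j or at k *)
pose e := Num.min (y 0 j - x 0 j) (x 0 k - y 0 k).
have e0 : 0 < e by rewrite lt_min !subr_gt0 xyj.
have ej : e <= y 0 j - x 0 j by rewrite ge_min lexx.
have ek : e <= x 0 k - y 0 k by rewrite ge_min lexx orbT.
have xkj : x 0 k <= x 0 j by apply: xdec; exact: ltnW.
have jNk : j != k by apply: contraTneq jk => ->; rewrite ltnn.
pose y' : 'rV[R]_m := \row_i (y 0 i - (i == j)%:R * e + (i == k)%:R * e).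
have y'E i : y' 0 i = y 0 i - (i == j)%:R * e + (i == k)%:R * e by rewrite mxE.
have sume (l : 'I_m) p : \sum_(i < m | (i < p)%N) (i == l)%:R * e = (l < p)%:R * e.
  rewrite -mulr_suml; congr (_ * _); rewrite big_mkcond/= (bigD1 l)//= eqxx big1.
    by rewrite addr0; case: ifP.
  by move=> i /negbTE ->; case: ifP.
apply: (IH y').
- have [eE|eE] : e = y 0 j - x 0 j \/ e = x 0 k - y 0 k.
    by rewrite /e; case: leP => _; [left|right].
  + apply: (@step _ j) => //; last 2 first.
    * by rewrite lt_eqF.
    * by rewrite y'E eqxx (negbTE jNk) mulr1n mulr0n eE; ring.
    move=> i xyi; rewrite y'E.
    case: eqVneq => [ij|_]; first by move: xyi xyj; rewrite ij => ->; rewrite ltxx.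
    case: eqVneq => [ik|_]; last by rewrite mulr0n; ring.
    by move: xyi yxk; rewrite ik => ->; rewrite ltxx.
  + apply: (@step _ k) => //; last 2 first.
    * by rewrite gt_eqF.
    * by rewrite y'E eqxx eq_sym (negbTE jNk) mulr1n mulr0n eE; ring.
    move=> i xyi; rewrite y'E.
    case: eqVneq => [ij|_]; first by move: xyi xyj; rewrite ij => ->; rewrite ltxx.
    case: eqVneq => [ik|_]; last by rewrite mulr0n; ring.
    by move: xyi yxk; rewrite ik => ->; rewrite ltxx.
(* only the prefixes ending between j and k lose mass, and there the slack at j
   is still counted in full since y >= x before k *)
- move=> p; under [leRHS]eq_bigr do rewrite y'E.
  rewrite big_split/= sumrB !sume.
  have [jp|jp] := ltnP j p; last first.
    by rewrite ltnNge (leq_trans jp (ltnW _))//= ?mul0r ?subr0 ?addr0; exact: xy.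
  have [kp|kp] := ltnP k p; first by rewrite subrK.
  rewrite mul1r mul0r addr0 lerBrDr.
  suff : e <= \sum_(i < m | (i < p)%N) (y 0 i - x 0 i) by rewrite sumrB; lra.
  rewrite (bigID (fun i : 'I_m => (i < j)%N))/=.
  rewrite [X in X + _](eq_bigl (fun i : 'I_m => (i < j)%N)); last first.
    by move=> i /=; apply/andb_idl => /leq_trans; apply; exact: ltnW.
  rewrite [X in _ + X](bigD1 j)/=; last by rewrite jp ltnn.
  have s1 : 0 <= \sum_(i < m | (i < j)%N) (y 0 i - x 0 i).
    by rewrite sumrB subr_ge0.
  have s2 : 0 <= \sum_(i < m | (i < p)%N && ~~ (i < j)%N && (i != j)) (y 0 i - x 0 i).
    apply: sumr_ge0 => i /andP[/andP[ip _] _]; rewrite subr_ge0 leNgt.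
    by apply/negP => /kmin; rewrite leqNgt (leq_trans ip kp).
  lra.
- pose t := 1 - e / (y 0 j - y 0 k).
  have yjk : 0 < y 0 j - y 0 k by lra.
  have -> : y' = t *: y + (1 - t) *: col_perm (tperm j k) y.
    have E : (1 - t) * (y 0 j - y 0 k) = e.
      by rewrite /t opprB addrC subrK divfK// gt_eqF.
    apply/rowP => i; rewrite !mxE; case: tpermP => [->|->|/eqP ij /eqP ik].
    + by rewrite eqxx (negbTE jNk) mulr1n mulr0n -E; ring.
    + by rewrite eqxx eq_sym (negbTE jNk) mulr1n mulr0n -E; ring.
    + by rewrite (negbTE ij) (negbTE ik) mulr0n; ring.
  apply: cH => //; last exact: pH.
  have : 0 <= e / (y 0 j - y 0 k) <= 1.
    rewrite divr_ge0 ?(ltW e0) ?(ltW yjk)//= ler_pdivrMr// mul1r; lra.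
  by rewrite /t => /andP[? ?]; apply/andP; split; lra.
Qed.

Lemma sort_coords m (x : 'rV[R]_m) :
  exists s : 'S_m, forall i j : 'I_m, (i <= j)%N ->
    col_perm s x 0 j <= col_perm s x 0 i.
Proof.
pose t := [tuple x 0 i | i < m].
have ge_total : total (>=%O : rel R) by move=> a b; exact: le_total.
have ge_trans : transitive (>=%O : rel R) by move=> a b c /= ba ac; exact: le_trans ac ba.
have : perm_eq (sort >=%O t) t by rewrite perm_sort.
move=> /tuple_permP[s sE]; exists s => i j ij; rewrite !mxE.
have szt : size (sort >=%O t) = m by rewrite size_sort size_tuple.
have nthE (l : 'I_m) : nth 0 (sort >=%O t) l = x 0 (s l).
  rewrite sE (nth_map l) ?size_enum_ord// nth_ord_enum tnth_mktuple.
  by [].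
rewrite -!nthE; apply: (@sorted_leq_nth _ >=%O) => //.
- by move=> a; exact: lexx.
- exact: sort_sorted.
- by rewrite inE szt.
- by rewrite inE szt.
Qed.

Theorem partial_permutohedronE m n :
  partial_permutohedron R m n = @polymatroid m n.
Proof.
apply/seteqP; split=> [x|x [x0 xJ]].
  apply; split; last exact: partial_perm_vectors_sub.
  by apply/convex_setP; exact: polymatroid_segment_closed.
pose H := partial_permutohedron R m n.
have cH : segment_closed H.
  move=> t u v t01 Hu Hv C CV; have /convex_setP cC := CV.1.
  by apply: cC => //; [exact: Hu|exact: Hv].
have pH s u : H u -> H (col_perm s u).
  move=> Hu C [/convex_setP cC VC].
  apply: (Hu [set w | C (col_perm s w)]); split.
    apply/convex_setP => t a b t01 Ca Cb /=.
    suff -> : col_perm s (t *: a + (1 - t) *: b) =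
      t *: col_perm s a + (1 - t) *: col_perm s b by exact: cC.
    by apply/rowP => i; rewrite !mxE.
  move=> w [wn winj]; apply: VC; split=> [i|i j ij]; rewrite !mxE.
    exact: wn.
  by apply: winj; rewrite (inj_eq perm_inj).
have zH i u : H u -> H (\row_j if j == i then 0 else u 0 j).
  move=> Hu C [/convex_setP cC VC].
  apply: (Hu [set w | C (\row_j if j == i then 0 else w 0 j)]); split.
    apply/convex_setP => t a b t01 Ca Cb /=.
    set w := (X in C X).
    suff -> : w = t *: (\row_j if j == i then 0 else a 0 j) +
      (1 - t) *: (\row_j if j == i then 0 else b 0 j) by exact: cC.
    by apply/rowP => j; rewrite !mxE; case: ifP => // _; rewrite !mulr0 addr0.
  move=> w [wn winj]; apply: VC; split=> [j|j k jk]; rewrite !mxE.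
    by case: ifP => _; [exists 0%N|exact: wn].
  by do 2![case: ifP => _; rewrite ?eqxx//]; exact: winj.
have [s xdec] := sort_coords x.
suff Hs : H (col_perm s x).
  suff -> : x = col_perm s^-1%g (col_perm s x) by exact: pH.
  by rewrite -col_permM mulVg col_perm1.
apply: (@dominated_mem _ H cH pH zH _ (\row_i (n - i)%:R)) => //.
- by move=> i; rewrite mxE.
- move=> k.
  pose J := [set i : 'I_m | (i < k)%N]%SET.
  have : \sum_(i in s @: J) x 0 i <= (cap n #|s @: J|)%:R by exact: xJ.
  rewrite big_imset/=; last by move=> ? ? _ _; exact: perm_inj.
  rewrite card_imset; last exact: perm_inj.
  rewrite (eq_bigl (fun i : 'I_m => (i < k)%N)); last by move=> i; rewrite inE.
  under [in X in _ -> X]eq_bigr do rewrite !mxE.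
  under [in X in _ -> _ <= X]eq_bigr do rewrite !mxE.
  move=> /le_trans; apply; rewrite -natr_sum ler_nat.
  have widen (F : nat -> nat) :
      (\sum_(i < m | i < k) F i = \sum_(i < minn k m) F i)%N.
    rewrite (big_ord_widen m F (geq_minr k m)).
    by apply: eq_bigl => i; rewrite leq_min ltn_ord andbT.
  rewrite /cap (widen (fun i => n - i)%N) -sum1_card.
  rewrite (eq_bigl (fun i : 'I_m => (i < k)%N)); last by move=> i; rewrite inE.
  by rewrite (widen (fun=> 1%N)) sum_nat_const card_ord muln1.
- apply: (fun (H : partial_perm_vectors R m n _) C (CV : _ /\ _) => CV.2 _ H).
  split=> [i|i j ij]; rewrite !mxE; first by exists (n - i)%N; rewrite ?leq_subr.
  rewrite !pnatr_eq0 eqr_nat => ni nj; move: ij; apply: contra => /eqP nij.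
  by apply/eqP/val_inj => /=; lia.
Qed.
End hull.

(** * Invariance of Lebesgue measure under permutations of coordinates *)

Section measure.
Context {R : realType}.

Lemma measurable_rect n (B : 'I_n -> set R) : (forall i, measurable (B i)) ->
  measurable [set t : n.-tuple R | forall i, B i (tnth t i)].
Proof.
move=> mB.
rewrite (_ : [set _ | _] =
  \bigcap_(i in [set: 'I_n]) ((@tnth _ R)^~ i @^-1` B i)).
  apply: fin_bigcap_measurable => // i _.
  by rewrite -[X in measurable X]setTI; exact: measurable_tnth.
by apply/seteqP; split=> [t H i _|t H i]; [exact: H|exact: (H i)].
Qed.

Lemma lebesgue_tuple_rect n (B : 'I_n -> set R) : (forall i, measurable (B i)) ->
  lebesgue_tuple [set t : n.-tuple R | forall i, B i (tnth t i)] =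
  (\prod_(i < n) lebesgue_measure (B i))%E.
Proof.
elim: n B => [|n IH] B mB.
  by rewrite /= big_ord0 diracE mem_set// => -[].
rewrite /= /pushforward.
have -> : @tcons R n @^-1` [set t | forall i, B i (tnth t i)] =
    B ord0 `*` [set t | forall i, B (lift ord0 i) (tnth t i)].
  apply/seteqP; split => [[x t]/= H|[x t] /= [H0 H1] i].
    split; first by have := H ord0; rewrite tnth0.
    by move=> i; have := H (lift ord0 i); rewrite tnthS.
  by case: (unliftP ord0 i) => [j|] ->; rewrite ?tnth0 ?tnthS.
have mB' (i : 'I_n) : measurable (B (lift ord0 i)) by exact: mB.
rewrite product_measure1E; [|exact: mB|exact: (measurable_rect mB')].
by rewrite /= (IH _ mB') big_ord_recl.
Qed.

Definition permt n (s : 'S_n) (t : n.-tuple R) : n.-tuple R :=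
  [tuple tnth t (s i) | i < n].

Lemma measurable_permt n s : measurable_fun setT (@permt n s).
Proof.
apply/measurable_fun_tnthP => i.
rewrite (_ : _ \o _ = (@tnth _ R)^~ (s i)); first exact: measurable_tnth.
by apply/funext => t /=; rewrite tnth_mktuple.
Qed.

(** Both sides are measures that agree on rectangles, which form a generating
    pi-system containing an exhaustion by cubes of finite measure. *)
Lemma lebesgue_tuple_perm n (s : 'S_n) (A : set (n.-tuple R)) : measurable A ->
  lebesgue_tuple (permt s @^-1` A) = lebesgue_tuple A.
Proof.
move=> mA.
pose m2 := measure_function_pushforward__canonical__measure_function_Measure
  (@lebesgue_tuple R n) (@measurable_permt n s).
rewrite -[LHS]/(m2 A).
pose G : set (set (n.-tuple R)) :=
  [set A | exists2 B : 'I_n -> set R, (forall i, measurable (B i)) &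
     A = [set t | forall i, B i (tnth t i)]].
pose g (k : nat) : set (n.-tuple R) :=
  [set t | forall i, `[(- k%:R), k%:R]%classic (tnth t i)].
apply/esym/(measure_unique G g) => //.
- apply/seteqP; split.
    apply: smallest_sub; first exact: smallest_sigma_algebra.
    move=> C; rewrite -bigcup_seq => -[i _ [B mB <-]].
    apply: sub_sigma_algebra; exists (fun j => if j == i then B else setT).
      by move=> j; case: ifP.
    apply/seteqP; split=> t /=.
      by move=> [_ Bt] j; case: eqVneq => [->|].
    by move=> /(_ i); rewrite eqxx.
  apply: smallest_sub; first exact: sigma_algebra_measurable.
  by move=> _ [B mB ->]; exact: measurable_rect.
- move=> _ _ [B mB ->] [C mC ->]; exists (fun i => B i `&` C i).
    by move=> i; exact: measurableI.
  by apply/seteqP; split=> t /= => [[Bt Ct] i|BCt]; [|split=> i; have [] := BCt i].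
- by move=> k; exists (fun=> `[(- k%:R), k%:R]%classic).
- apply/seteqP; split=> // t _.
  pose M := \sum_(i < n) `|tnth t i|.
  exists (Num.truncn M).+1 => // i /=; rewrite in_itv/= -ler_norml.
  apply: le_trans (ltW (truncnS_gt M)).
  by rewrite /M (bigD1 i)//= lerDl sumr_ge0.
- move=> _ [B mB ->].
  rewrite /m2 /= /pushforward.
  have -> : permt s @^-1` [set t | forall i, B i (tnth t i)] =
      [set t | forall i, B (s^-1%g i) (tnth t i)].
    apply/seteqP; split=> t /= Bt i.
      by have := Bt (s^-1%g i); rewrite tnth_mktuple permKV.
    by rewrite tnth_mktuple; have := Bt (s i); rewrite permK.
  rewrite lebesgue_tuple_rect// (@lebesgue_tuple_rect _ (fun i => B (s^-1%g i)))//.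
  rewrite [RHS](reindex_inj (@perm_inj _ s))/=.
  by apply: eq_bigr => i _; rewrite permK.
- move=> k; rewrite -[X in (X < _)%E]/(lebesgue_tuple (g k)) /g
    (@lebesgue_tuple_rect _ (fun=> `[(- k%:R), k%:R]%classic))//.
  rewrite (eq_bigr (fun=> (k%:R + k%:R : R)%:E)) => [|i _].
    by rewrite prodEFin ltry.
  rewrite /= lebesgue_measure_itv/= lte_fin.
  case: ltP => [_|kk]; first by rewrite opprK.
  by congr EFin; have : (0 : R) <= k%:R by []; lra.
Qed.

Lemma lebesgue_tuple_slice n (A : set (n.+1.-tuple R)) : measurable A ->
  lebesgue_tuple A =
  (\int[lebesgue_measure]_x lebesgue_tuple [set t | A (tcons (x, t))])%E.
Proof.
move=> mA; rewrite /= /pushforward /product_measure1; apply: eq_integral => x _ /=.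
by congr lebesgue_tuple; apply/seteqP; split => t /=; rewrite /xsection/= inE.
Qed.

End measure.

(** * Truncated powers, the volumes of simplices *)

Section spow.
Context {R : realType}.
Implicit Types a b c : R.

(** The volume of the simplex x >= 0, sum x <= c in dimension n. The two
    branches meet continuously only for n > 0: for n = 0 this is the indicator
    of c >= 0. *)
Definition spow n c : R := if 0 <= c then c ^+ n / n`!%:R else 0.

Lemma spow_ge0 n c : 0 <= spow n c.
Proof. by rewrite /spow; case: ifP => // c0; rewrite divr_ge0// exprn_ge0. Qed.

Lemma spow_le0 n c : c <= 0 -> spow n.+1 c = 0.
Proof.
move=> c0; rewrite /spow; case: ifP => // c0'.
have -> : c = 0 by apply/eqP; rewrite eq_le c0.
by rewrite expr0n mul0r.
Qed.

Lemma spowE n c : 0 <= c -> spow n c = c ^+ n / n`!%:R.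
Proof. by rewrite /spow => ->. Qed.

Lemma measurable_spow n c :
  measurable_fun [set: R] (fun x => spow n (c - x)).
Proof.
rewrite /spow; apply: measurable_fun_ifT => //=.
- by apply: measurable_fun_ler => //; exact: measurable_funB.
- apply: measurable_funM => //; apply: measurable_funX.
  exact: measurable_funB.
Qed.

(** The integrand is polynomial up to c and vanishes beyond, so the integral is
    over the segment from a to c, where the fundamental theorem of calculus
    applies. *)
Lemma integral_spow_cy n c a :
  (\int[lebesgue_measure]_(x in `[a, +oo[) (spow n (c - x))%:E =
   (spow n.+1 (c - a))%:E)%E.
Proof.
have [ca|ac] := ltP c a.
  rewrite spow_le0 ?subr_le0 ?ltW//; apply: integral0_eq => x /=.
  rewrite in_itv/= andbT => ax.
  by rewrite /spow ifF//; apply/negbTE; rewrite -ltNge subr_lt0 (lt_le_trans ca).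
pose f x := (c - x) ^+ n / n`!%:R.
transitivity (\int[lebesgue_measure]_(x in `[a, c]) (f x)%:E)%E.
  rewrite integral_mkcond [RHS]integral_mkcond; apply: eq_integral => x _.
  rewrite !patchE !mem_setE !in_itv/= andbT /spow subr_ge0.
  by have [ax|//] := leP a x; case: leP.
have [<-|aNc] := eqVneq a c.
  by rewrite set_itv1 integral_set1 subrr spow_le0.
have {aNc} altc : a < c by rewrite lt_neqAle aNc.
pose F x := - ((c - x) ^+ n.+1 / n.+1`!%:R).
have dF (x : R) : is_derive x 1 F (f x).
  rewrite (_ : F = - (n.+1`!%:R^-1 *: ((cst c - id) ^+ n.+1))); last first.
    by apply/funext => y; rewrite /F !fctE [_ *: _]mulrC.
  apply: is_derive_eq.
  rewrite /f sub0r scalerN scaler1 !scalerN opprK.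
  rewrite -mulr_natl /GRing.scale/= factS natrM invfM.
  rewrite !fctE.
  have n0 : n.+1%:R != 0 :> R by rewrite pnatr_eq0.
  have fn0 : n`!%:R != 0 :> R by rewrite pnatr_eq0 -lt0n fact_gt0.
  by field; rewrite fn0 nat1r n0.
have cF (x : R) : {for x, continuous F}.
  by apply: differentiable_continuous; apply/derivable1_diffP; exact: ex_derive.
have cf (x : R) : {for x, continuous f}.
  apply: differentiable_continuous; apply/derivable1_diffP.
  rewrite (_ : f = n`!%:R^-1 *: ((cst c - id) ^+ n)); first exact: ex_derive.
  by apply/funext => y; rewrite /f !fctE [_ *: _]mulrC.
rewrite (continuous_FTC2 (F := F))//.
- by rewrite /F subrr expr0n/= mul0r oppr0 -EFinB sub0r opprK spowE// subr_ge0.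
- by apply: continuous_subspaceT; exact: cf.
- split=> [x _||]; first exact: ex_derive.
  + by apply: cvg_at_right_filter; exact: cF.
  + by apply: cvg_at_left_filter; exact: cF.
- by move=> x _; rewrite derive1E; apply: derive_val.
Qed.

Lemma integral_spow_oy n c a :
  (\int[lebesgue_measure]_(x in `]a, +oo[) (spow n (c - x))%:E =
   (spow n.+1 (c - a))%:E)%E.
Proof.
rewrite -integral_spow_cy integral_itv_obnd_cbnd//.
by apply/measurable_EFinP/measurable_funTS; exact: measurable_spow.
Qed.

Lemma integral_spow_oc n c a b : a <= b ->
  (\int[lebesgue_measure]_(x in `]a, b]) (spow n (c - x))%:E =
   (spow n.+1 (c - a) - spow n.+1 (c - b))%:E)%E.
Proof.
move=> ab; rewrite EFinB -(integral_spow_oy n c a).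
have -> : `]a, +oo[%classic = `]a, b]%classic `|` `]b, +oo[%classic.
  by rewrite -itv_bndbnd_setU.
rewrite ge0_integral_setU//=.
- by rewrite integral_spow_oy addeK.
- by apply/measurable_EFinP/measurable_funTS; exact: measurable_spow.
- by move=> x _; rewrite lee_fin spow_ge0.
- rewrite disj_set2E; apply/eqP/seteqP; split=> // x /= [].
  by rewrite !in_itv/= andbT => /andP[_ xb]; rewrite ltNge xb.
Qed.


End spow.

(** * Slicing regions along their first coordinates *)

Section boolean_regions.
Context {R : realType}.
Implicit Types a b c : R.

Lemma measurable_forall d (T : measurableType d) (I : finType) (b : I -> T -> bool) :
  (forall i, measurable_fun setT (b i)) ->
  measurable_fun setT (fun t => [forall i, b i t]).
Proof.
move=> mb mD; apply: (measurable_fun_bool true) => //.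
rewrite setTI (_ : _ @^-1` _ = \bigcap_(i in [set: I]) (b i @^-1` [set true])).
  apply: fin_bigcap_measurable => // i _.
  by rewrite -[X in measurable X]setTI; exact: mb.
apply/seteqP; split=> [t /= /forallP bt i _|t bt]; first exact: bt.
by apply/forallP => i; exact: bt.
Qed.

Lemma measurable_boolset d (T : measurableType d) (b : T -> bool) :
  measurable_fun setT b -> measurable [set t | b t].
Proof. by move=> mb; rewrite -[X in measurable X]setTI; exact: (mb _ [set true]). Qed.

Lemma measurable_sum_tnth n (r : seq 'I_n) (P : pred 'I_n) :
  measurable_fun setT (fun t : n.-tuple R => \sum_(i <- r | P i) tnth t i).
Proof.
under eq_fun do rewrite big_mkcond/=.
by apply: measurable_sum => i; case: (P i) => //; exact: measurable_tnth.
Qed.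

Definition in_simplex n c (t : n.-tuple R) :=
  [forall i, 0 <= tnth t i] && (\sum_(i < n) tnth t i <= c).

Lemma measurable_in_simplex n c : measurable_fun setT (@in_simplex n c).
Proof.
apply: measurable_and.
  apply: measurable_forall => i; apply: measurable_fun_ler => //.
  exact: measurable_tnth.
by apply: measurable_fun_ler => //; exact: measurable_sum_tnth.
Qed.

Lemma in_simplex_cons n c x (t : n.-tuple R) :
  in_simplex c (tcons (x, t)) = (0 <= x) && in_simplex (c - x) t.
Proof.
rewrite /in_simplex andbA; congr (_ && _).
  apply/forallP/andP => [t0|[x0 /forallP t0] i].
    split; first by have := t0 ord0; rewrite tnth0.
    by apply/forallP => i; have := t0 (lift ord0 i); rewrite tnthS.
  by case: (unliftP ord0 i) => [j|] ->; rewrite ?tnth0 ?tnthS.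
rewrite big_ord_recl tnth0; under eq_bigr do rewrite tnthS.
by rewrite lerBrDl.
Qed.

Lemma volume_slice n (D : n.+1.-tuple R -> bool) : measurable_fun setT D ->
  lebesgue_tuple [set t | D t] =
  (\int[lebesgue_measure]_x lebesgue_tuple [set t | D (tcons (x, t))])%E.
Proof. by move=> mD; rewrite lebesgue_tuple_slice//; exact: measurable_boolset. Qed.

Lemma measurable_slice n (D : n.+1.-tuple R -> bool) x :
  measurable_fun setT D -> measurable_fun setT (fun t => D (tcons (x, t))).
Proof.
move=> mD; apply: (measurableT_comp mD).
by apply: measurable_cons => //; exact: measurable_id.
Qed.

Lemma integral_if (P : R -> bool) (I : interval R) (f : R -> R) :
  (forall x, P x = (x \in I)) ->
  (\int[lebesgue_measure]_x (if P x then f x else 0)%:E =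
   \int[lebesgue_measure]_(x in [set` I]) (f x)%:E)%E.
Proof.
move=> PI; rewrite [RHS]integral_mkcond; apply: eq_integral => x _.
by rewrite patchE mem_setE PI; case: ifP.
Qed.

Lemma volume_simplex n c :
  lebesgue_tuple [set t : n.-tuple R | in_simplex c t] = (spow n c)%:E.
Proof.
elim: n c => [|n IH] c.
  rewrite /= diracE /spow expr0 fact0 divr1.
  case: ifP => c0; first by rewrite mem_set//= /in_simplex big_ord0 c0 andbT;
    apply/forallP => -[].
  by rewrite memNset//= /in_simplex big_ord0 c0 andbF.
rewrite volume_slice; last exact: measurable_in_simplex.
rewrite -[c in RHS]subr0 -integral_spow_cy -(@integral_if (fun x => 0 <= x)).
  apply: eq_integral => x _; case: ifP => x0.
    by rewrite -IH; congr lebesgue_tuple; apply/funext => t /=; rewrite in_simplex_cons x0.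
  rewrite (_ : [set _ | _] = set0) ?measure0//.
  by apply/seteqP; split=> // t /=; rewrite in_simplex_cons x0.
by move=> x; rewrite in_itv/= andbT.
Qed.

Lemma volume_if_simplex n (b : bool) c :
  lebesgue_tuple [set t : n.-tuple R | b && in_simplex c t] =
  (if b then spow n c else 0)%:E.
Proof.
case: b; first exact: volume_simplex.
rewrite (_ : [set _ | _] = set0) ?measure0//.
by apply/seteqP; split.
Qed.

(** Fixing the first coordinates turns each region below into a simplex or into
    the empty set; the next three lemmas integrate out one, two and three of
    them. *)
Lemma volume_head1 n (D : n.+1.-tuple R -> bool) (P : R -> bool) c :
  measurable_fun setT D ->
  (forall x t, D (tcons (x, t)) = P x && in_simplex (c - x) t) ->
  lebesgue_tuple [set t | D t] =
  (\int[lebesgue_measure]_x (if P x then spow n (c - x) else 0)%:E)%E.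
Proof.
move=> mD DE; apply: (etrans (volume_slice mD)); apply: eq_integral => x _.
by rewrite -volume_if_simplex; congr lebesgue_tuple; apply/funext => t /=; rewrite DE.
Qed.

Lemma volume_head2 n (D : n.+2.-tuple R -> bool) (P : R -> R -> bool) c :
  measurable_fun setT D ->
  (forall x y t, D (tcons (x, tcons (y, t))) = P x y && in_simplex (c - x - y) t) ->
  lebesgue_tuple [set t | D t] =
  (\int[lebesgue_measure]_x \int[lebesgue_measure]_y
     (if P x y then spow n (c - x - y) else 0)%:E)%E.
Proof.
move=> mD DE; apply: (etrans (volume_slice mD)); apply: eq_integral => x _.
by apply: volume_head1 => [|y t]; [exact: measurable_slice|exact: DE].
Qed.

Lemma volume_head3 n (D : n.+3.-tuple R -> bool) (P : R -> R -> R -> bool) c :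
  measurable_fun setT D ->
  (forall x y z t, D (tcons (x, tcons (y, tcons (z, t)))) =
     P x y z && in_simplex (c - x - y - z) t) ->
  lebesgue_tuple [set t | D t] =
  (\int[lebesgue_measure]_x \int[lebesgue_measure]_y \int[lebesgue_measure]_z
     (if P x y z then spow n (c - x - y - z) else 0)%:E)%E.
Proof.
move=> mD DE; apply: (etrans (volume_slice mD)); apply: eq_integral => x _.
by apply: volume_head2 => [|y z t]; [exact: measurable_slice|exact: DE].
Qed.

Lemma integrable_spow n c a b : a <= b ->
  lebesgue_measure.-integrable `]a, b] (EFin \o (fun x => spow n (c - x))).
Proof.
move=> ab; apply/integrableP; split.
  by apply/measurable_EFinP/measurable_funTS; exact: measurable_spow.
under eq_integral => x _ do rewrite /= ger0_norm ?spow_ge0//.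
by rewrite integral_spow_oc// ltry.
Qed.

(** The integrands that occur after the innermost integrations are all of this
    shape; affine functions are covered since spow 1 (b - x) = b - x on the
    interval. *)
Lemma integral_comb n c a b k0 k1 k2 : a <= b ->
  (\int[lebesgue_measure]_(x in `]a, b])
     (k0 + (k1 * spow 1 (b - x) + k2 * spow n (c - x)))%:E =
   (k0 * (b - a) + (k1 * ((b - a) ^+ 2 / 2) +
     k2 * (spow n.+1 (c - a) - spow n.+1 (c - b))))%:E)%E.
Proof.
move=> ab; have mab : measurable (`]a, b] : set R) by [].
have i1 := @integrable_spow 1 b a b ab.
have i2 := @integrable_spow n c a b ab.
have i0 : lebesgue_measure.-integrable `]a, b] (EFin \o (fun=> k0 : R)).
  apply/integrableP; split; first exact/measurable_EFinP.
  rewrite integral_cst//= lebesgue_measure_itv/=.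
  by case: ifP => _; rewrite ?mule0 ?ltry// -EFinB -EFinM ltry.
have Zi k n' c' : lebesgue_measure.-integrable `]a, b] (EFin \o (fun x => k * spow n' (c' - x))).
  rewrite (_ : _ \o _ = (fun x => k%:E * (EFin \o (fun x => spow n' (c' - x))) x)%E)//.
  by apply: integrableZl => //; exact: integrable_spow.
have Zint k n' c' : (\int[lebesgue_measure]_(x in `]a, b]) (k * spow n' (c' - x))%:E =
    (k * (spow n'.+1 (c' - a) - spow n'.+1 (c' - b)))%:E)%E.
  under eq_integral => x _ do rewrite EFinM.
  rewrite integralZl//; first by rewrite integral_spow_oc.
  exact: integrable_spow.
under eq_integral => x _ do rewrite EFinD.
rewrite integralD//=; last first.
  rewrite (_ : (fun _ => _) = (fun x => (k1 * spow 1 (b - x))%:E + (k2 * spow n (c - x))%:E)%E).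
    by apply: integrableD => //; exact: Zi.
  by apply/funext => x; rewrite EFinD.
under [X in (_ + X)%E]eq_integral => x _ do rewrite EFinD.
rewrite integralD//=; [|exact: Zi|exact: Zi].
rewrite !Zint integral_cst//= lebesgue_measure_itv/= lte_fin.
rewrite [RHS]EFinD; congr (_ + _)%E.
  by move: ab; rewrite le_eqVlt => /predU1P[->|->]; rewrite ?ltxx ?subrr ?mulr0 ?mule0 // -EFinM.
by rewrite -EFinD; congr (_ * _ + _)%:E; rewrite subrr (spow_le0 1 (lexx 0)) subr0 spowE ?subr_ge0.
Qed.

End boolean_regions.

(** * Volumes of the regions where the inequalities fail *)

Section volumes.
Context {R : realType}.

Local Notation mu := (@lebesgue_measure R).

Definition first n k : {set 'I_n} := [set i : 'I_n | (i < k)%N]%SET.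

Definition above m (J : {set 'I_m}) (t : m.-tuple R) :=
  in_simplex 10 t && [forall i in J, 4 < tnth t i].

Definition excess (c : R) m (J : {set 'I_m}) (t : m.-tuple R) :=
  [&& in_simplex 10 t, [forall i in J, tnth t i <= 4]
    & c < \sum_(i in J) tnth t i].

Definition double_excess m (J : {set 'I_m}) i (t : m.-tuple R) :=
  excess 9 J t && (7 < \sum_(j in J :\ i) tnth t j).

Lemma measurable_above m (J : {set 'I_m}) : measurable_fun setT (above J).
Proof.
apply: measurable_and; first exact: measurable_in_simplex.
apply: measurable_forall => i; case: (i \in J) => //=.
by apply: measurable_fun_ltr => //; exact: measurable_tnth.
Qed.

Lemma measurable_excess c m (J : {set 'I_m}) : measurable_fun setT (excess c J).
Proof.
apply: measurable_and; first exact: measurable_in_simplex.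
apply: measurable_and.
  apply: measurable_forall => i; case: (i \in J) => //=.
  by apply: measurable_fun_ler => //; exact: measurable_tnth.
by apply: measurable_fun_ltr => //; exact: measurable_sum_tnth.
Qed.

Lemma measurable_double_excess m (J : {set 'I_m}) i :
  measurable_fun setT (double_excess J i).
Proof.
apply: measurable_and; first exact: measurable_excess.
by apply: measurable_fun_ltr => //; exact: measurable_sum_tnth.
Qed.

Lemma sum_first0 n (t : n.-tuple R) : \sum_(i in first n 0) tnth t i = 0.
Proof. by apply: big1 => i; rewrite inE. Qed.

Lemma sum_firstS n k x (t : n.-tuple R) :
  \sum_(i in first n.+1 k.+1) tnth (tcons (x, t)) i =
  x + \sum_(i in first n k) tnth t i.
Proof.
rewrite big_mkcond big_ord_recl inE /= tnth0; congr (_ + _).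
rewrite [RHS]big_mkcond; apply: eq_bigr => i _.
by rewrite !inE lift0 ltnS tnthS.
Qed.

Lemma forall_first0 n (p : R -> bool) (t : n.-tuple R) :
  [forall i in first n 0, p (tnth t i)].
Proof. by apply/forallP => i; rewrite inE. Qed.

Lemma forall_firstS n k x (p : R -> bool) (t : n.-tuple R) :
  [forall i in first n.+1 k.+1, p (tnth (tcons (x, t)) i)] =
  p x && [forall i in first n k, p (tnth t i)].
Proof.
apply/forallP/andP => [px|[px /forallP pt] i].
  split; first by have := px ord0; rewrite inE tnth0.
  apply/forallP => i; have := px (lift ord0 i).
  by rewrite !inE lift0 ltnS tnthS.
case: (unliftP ord0 i) => [j|] ->; last by rewrite inE tnth0.
by have := pt j; rewrite !inE lift0 ltnS tnthS.
Qed.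

(** Besides confining x to I, the condition may force a constraint b on the
    coordinates that have been fixed before. *)
Lemma integral_if_and (b : bool) (P : R -> bool) (I : interval R) (f : R -> R) :
  (forall x, P x = b && (x \in I)) ->
  (\int[mu]_x (if P x then f x else 0)%:E =
   if b then \int[mu]_(x in [set` I]) (f x)%:E else 0)%E.
Proof.
case: b => PI; first exact: integral_if.
by apply: integral0_eq => x _; rewrite PI.
Qed.

Lemma volume_above1 n :
  lebesgue_tuple [set t | above (first n.+1 1) t] = (spow n.+1 6)%:E.
Proof.
rewrite (@volume_head1 _ _ _ (fun x => 4 < x) 10); last 2 first.
- exact: measurable_above.
- move=> x t; rewrite /above (forall_firstS _ _ (fun y => 4 < y)).
  rewrite (forall_first0 (fun y => 4 < y)) andbT in_simplex_cons.
  apply/idP/idP => [/andP[/andP[_ ->]] ->//|/andP[x4 ->]].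
  by rewrite x4 !andbT; lra.
rewrite (@integral_if _ _ `]4, +oo[); last by move=> x; rewrite in_itv/= andbT.
by rewrite integral_spow_oy; congr (spow _ _)%:E; ring.
Qed.

Lemma volume_above2 n :
  lebesgue_tuple [set t | above (first n.+2 2) t] = (spow n.+2 2)%:E.
Proof.
rewrite (@volume_head2 _ _ _ (fun x y => (4 < x) && (4 < y)) 10); last 2 first.
- exact: measurable_above.
- move=> x y t; rewrite /above !(forall_firstS _ _ (fun y => 4 < y)).
  rewrite (forall_first0 (fun y => 4 < y)) andbT !in_simplex_cons.
  apply/idP/idP => [/andP[/and3P[_ _ ->] ->]//|/andP[/andP[x4 y4] ->]].
  by rewrite x4 y4 !andbT; apply/andP; split; lra.
transitivity (\int[mu]_x
    (if 4 < x then spow n.+1 (6 - x) else 0)%:E)%E.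
  apply: eq_integral => x _.
  rewrite (@integral_if_and (4 < x) _ `]4, +oo[); last first.
    by move=> y; rewrite in_itv/= andbT.
  by case: ifP => // _; rewrite integral_spow_oy; congr (spow _ _)%:E; ring.
rewrite (@integral_if _ _ `]4, +oo[); last by move=> x; rewrite in_itv/= andbT.
by rewrite integral_spow_oy; congr (spow _ _)%:E; ring.
Qed.

(** The bound 7 < x + y together with x, y <= 4 forces x, y > 3: the region is
    the triangle 3 < x <= 4, 7 - x < y <= 4, over which the other coordinates
    form a simplex of size 10 - x - y. *)
Lemma volume_excess2 n :
  lebesgue_tuple [set t | excess 7 (first n.+2 2) t] =
  (spow n.+1 3 - spow n.+2 3 + spow n.+2 2)%:E.
Proof.
rewrite (@volume_head2 _ _ _ (fun x y => [&& x <= 4, y <= 4 & 7 < x + y]) 10);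
    last 2 first.
- exact: measurable_excess.
- move=> x y t; rewrite /excess !(forall_firstS _ _ (fun y => y <= 4)).
  rewrite (forall_first0 (fun y => y <= 4)) andbT !in_simplex_cons.
  rewrite !sum_firstS sum_first0 addr0.
  apply/idP/idP => [/and3P[/and3P[_ _ ->] /andP[-> ->] ->]//|].
  move=> /andP[/and3P[x4 y4 xy] ->]; rewrite x4 y4 xy !andbT.
  by apply/andP; split; lra.
transitivity (\int[mu]_x (if 3 < x <= 4 then
    spow n.+1 3 + (0 * spow 1 (4 - x) + (-1) * spow n.+1 (6 - x)) else 0)%:E)%E.
  apply: eq_integral => x _.
  rewrite (@integral_if_and (3 < x <= 4) _ `]7 - x, 4]); last first.
    move=> y; rewrite in_itv/=; apply/idP/idP.
      move=> /and3P[x4 y4 xy]; apply/andP; split; apply/andP; split; lra.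
    move=> /andP[/andP[x3 x4] /andP[xy y4]]; apply/and3P; split; lra.
  case: ifP => // /andP[x3 x4]; rewrite integral_spow_oc; last by lra.
  rewrite (_ : 10 - x - (7 - x) = 3); last by ring.
  by rewrite (_ : 10 - x - 4 = 6 - x); [congr EFin|]; ring.
rewrite (@integral_if _ _ `]3, 4]); last by move=> x; rewrite in_itv.
rewrite integral_comb; last by lra.
rewrite (_ : 6 - 3 = 3 :> R); last by ring.
rewrite (_ : 6 - 4 = 2 :> R); last by ring.
by congr EFin; ring.
Qed.

(** As before, the conditions amount to 1 < x <= 4, 5 - x < y <= 4 and
    9 - x - y < z <= 4. The simplex size 10 - x - y - z may be negative there,
    which the truncation in spow takes into account. *)
Lemma volume_excess3 n :
  lebesgue_tuple [set t | excess 9 (first n.+3 3) t] =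
  (9 / 2 * spow n.+1 1 - 3 * spow n.+2 1 + spow n.+3 1)%:E.
Proof.
rewrite (@volume_head3 _ _ _
    (fun x y z => [&& x <= 4, y <= 4, z <= 4 & 9 < x + y + z]) 10); last 2 first.
- exact: measurable_excess.
- move=> x y z t; rewrite /excess !(forall_firstS _ _ (fun y => y <= 4)).
  rewrite (forall_first0 (fun y => y <= 4)) andbT !in_simplex_cons.
  rewrite !sum_firstS sum_first0 addr0 !addrA.
  apply/idP/idP => [/and3P[/and4P[_ _ _ ->] /and3P[-> -> ->] ->]//|].
  move=> /andP[/and4P[x4 y4 z4 xyz] ->]; rewrite x4 y4 z4 xyz !andbT.
  by apply/and3P; split; lra.
transitivity (\int[mu]_x (if 1 < x <= 4 then
    (3 * spow n.+1 1 - spow n.+2 1) + ((- spow n.+1 1) * spow 1 (4 - x) +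
    1 * spow n.+2 (2 - x)) else 0)%:E)%E.
  apply: eq_integral => x _.
  transitivity (\int[mu]_y (if (1 < x <= 4) && (5 - x < y <= 4) then
    spow n.+1 1 + (0 * spow 1 (4 - y) + (-1) * spow n.+1 (6 - x - y)) else 0)%:E)%E.
    apply: eq_integral => y _.
    rewrite (@integral_if_and ((1 < x <= 4) && (5 - x < y <= 4)) _
      `]9 - x - y, 4]); last first.
      move=> z; rewrite in_itv/=; apply/idP/idP.
        move=> /and4P[x4 y4 z4 xyz]; apply/andP; split; last by apply/andP; split; lra.
        by apply/andP; split; apply/andP; split; lra.
      move=> /andP[/andP[/andP[x1 x4] /andP[xy y4]] /andP[xyz z4]].
      by apply/and4P; split; lra.
    case: ifP => // /andP[/andP[x1 x4] /andP[xy y4]].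
    rewrite integral_spow_oc; last by lra.
    rewrite (_ : 10 - x - y - (9 - x - y) = 1); last by ring.
    by rewrite (_ : 10 - x - y - 4 = 6 - x - y); [congr EFin|]; ring.
  rewrite (@integral_if_and (1 < x <= 4) _ `]5 - x, 4]); last first.
    by move=> y; rewrite in_itv.
  case: ifP => // /andP[x1 x4]; rewrite integral_comb; last by lra.
  rewrite (_ : 6 - x - (5 - x) = 1); last by ring.
  rewrite (_ : 6 - x - 4 = 2 - x); last by ring.
  have -> : spow 1 (4 - x) = 4 - x by rewrite spowE ?expr1 ?divr1//; lra.
  by congr EFin; ring.
rewrite (@integral_if _ _ `]1, 4]); last by move=> x; rewrite in_itv.
rewrite integral_comb; last by lra.
rewrite (_ : 2 - 1 = 1 :> R); last by ring.
rewrite (@spow_le0 _ _ (2 - 4)); last by lra.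
by congr EFin; field.
Qed.

(** The removed index i is the third one, so the excessive pair is formed by the
    first two coordinates x and y. As x + y > 7 and the total is at most 10, the
    third coordinate stays below 3 and its upper bound 4 is automatic: z ranges
    over a half-line, and the integral over z is the constant spow n.+1 1. *)
Lemma volume_double_excess n (i : 'I_n.+3) : i = 2%N :> nat ->
  lebesgue_tuple [set t | double_excess (first n.+3 3) i t] =
  (1 / 2 * spow n.+1 1)%:E.
Proof.
move=> i2; have firstD1 : (first n.+3 3 :\ i)%SET = first n.+3 2.
  apply/setP => j; rewrite !inE -val_eqE/= i2 ltnS [in RHS]ltn_neqAle.
  by rewrite -ltnS ltnS.
rewrite (@volume_head3 _ _ _
    (fun x y z => [&& x <= 4, y <= 4, 7 < x + y & 9 < x + y + z]) 10); last 2 first.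
- exact: measurable_double_excess.
- move=> x y z t; rewrite /double_excess firstD1 /excess.
  rewrite !(forall_firstS _ _ (fun y => y <= 4)).
  rewrite (forall_first0 (fun y => y <= 4)) andbT !in_simplex_cons.
  rewrite !sum_firstS !sum_first0 !addr0 !addrA.
  apply/idP/idP.
    by move=> /andP[/and3P[/and4P[_ _ _ ->] /and3P[-> -> _] ->] ->].
  move=> /andP[/and4P[x4 y4 xy xyz] st]; rewrite x4 y4 xy xyz st !andbT.
  have /andP[/forallP t0 ts] := st.
  have : 0 <= \sum_(i < n) tnth t i by apply: sumr_ge0 => j _; exact: t0.
  by move=> ?; apply/andP; split; [apply/and3P; split|]; lra.
transitivity (\int[mu]_x (if 3 < x <= 4 then
    spow n.+1 1 + ((- spow n.+1 1) * spow 1 (4 - x) +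
    0 * spow 1 (4 - x)) else 0)%:E)%E.
  apply: eq_integral => x _.
  transitivity (\int[mu]_y (if (3 < x <= 4) && (7 - x < y <= 4) then
    spow n.+1 1 + (0 * spow 1 (4 - y) + 0 * spow 1 (4 - y)) else 0)%:E)%E.
    apply: eq_integral => y _.
    rewrite (@integral_if_and ((3 < x <= 4) && (7 - x < y <= 4)) _
      `]9 - x - y, +oo[); last first.
      move=> z; rewrite in_itv/= andbT; apply/idP/idP.
        move=> /and4P[x4 y4 xy xyz]; apply/andP; split; last by lra.
        by apply/andP; split; apply/andP; split; lra.
      move=> /andP[/andP[/andP[x1 x4] /andP[xy y4]] xyz].
      by apply/and4P; split; lra.
    case: ifP => // _; rewrite integral_spow_oy.
    rewrite (_ : 10 - x - y - (9 - x - y) = 1); last by ring.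
    by congr EFin; ring.
  rewrite (@integral_if_and (3 < x <= 4) _ `]7 - x, 4]); last first.
    by move=> y; rewrite in_itv.
  case: ifP => // /andP[x1 x4]; rewrite integral_comb; last by lra.
  have -> : spow 1 (4 - x) = 4 - x by rewrite spowE ?expr1 ?divr1//; lra.
  by congr EFin; ring.
rewrite (@integral_if _ _ `]3, 4]); last by move=> x; rewrite in_itv.
rewrite integral_comb; last by lra.
by congr EFin; field.
Qed.

End volumes.

(** * Reduction to the first coordinates *)

Section symmetry.
Context {R : realType}.

(** Exchanging an element of J outside K with an element of K outside J brings J
    closer to K. *)
Lemma exists_perm_set (T : finType) (J K : {set T}) : #|J| = #|K| ->
  exists s : {perm T}, s @: J = K.
Proof.
have [d] := ubnP #|J :\: K|; elim: d J => // d IH J dJ JK.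
have [JK0|[i]] := set_0Vmem (J :\: K).
  exists 1%g; rewrite (eq_imset _ (@perm1 _)) imset_id.
  by apply/eqP; rewrite eqEcard -finset.setD_eq0 JK0 eqxx JK leqnn.
rewrite inE => /andP[iK iJ].
have [KJ0|[j]] := set_0Vmem (K :\: J).
  have : (K \proper J)%SET.
    by rewrite properE -finset.setD_eq0 KJ0 eqxx; apply/subsetPn; exists i.
  by move=> /proper_card; rewrite JK ltnn.
rewrite inE => /andP[jJ jK].
have [//||s sE] := IH (tperm i j @: J); last first.
- by exists (tperm i j * s)%g; rewrite -sE -imset_comp; apply: eq_imset => x; rewrite permM.
- by rewrite card_imset//; exact: perm_inj.
- rewrite -ltnS; apply: leq_trans dJ; rewrite ltnS; apply: proper_card.
  apply/properP; split.
    apply/fintype.subsetP => x; rewrite !inE => /andP[xK /imsetP[y yJ xy]].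
    move: xy xK; case: tpermP => [_ ->|yj|_ _ -> ->//]; first by rewrite jK.
    by rewrite yj (negbTE jJ) in yJ.
  exists i; first by rewrite inE iK.
  rewrite inE iK /=; apply/imsetP => -[y yJ].
  case: tpermP => [_ ij|yj|yi _ iy].
  + by move: iK; rewrite ij jK.
  + by move: yJ; rewrite yj (negbTE jJ).
  + by case: yi.
Qed.

Lemma exists_perm_pointed (T : finType) (J K : {set T}) i j : #|J| = #|K| ->
  i \in J -> j \in K -> exists2 s : {perm T}, s @: J = K & s i = j.
Proof.
move=> JK iJ jK; have [s sJ] := exists_perm_set JK.
have siK : s i \in K by rewrite -sJ; apply: imset_f.
exists (s * tperm (s i) j)%g; last by rewrite permM tpermL.
apply/eqP; rewrite eqEcard card_imset ?JK ?leqnn ?andbT; last exact: perm_inj.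
apply/fintype.subsetP => _ /imsetP[x xJ ->]; rewrite permM.
have : s x \in K by rewrite -sJ; apply: imset_f.
by case: tpermP => [_|-> _|].
Qed.

Lemma in_simplex_perm m c (s : 'S_m) (t : m.-tuple R) :
  in_simplex c (permt s t) = in_simplex c t.
Proof.
rewrite /in_simplex [in RHS](reindex_inj (@perm_inj _ s))/=.
under eq_bigr do rewrite tnth_mktuple.
congr (_ && _); apply/forallP/forallP => t0 i.
  by have := t0 (s^-1%g i); rewrite tnth_mktuple permKV.
by rewrite tnth_mktuple.
Qed.

Lemma sum_perm m (s : 'S_m) (J : {set 'I_m}) (t : m.-tuple R) :
  \sum_(i in s @: J) tnth t i = \sum_(i in J) tnth (permt s t) i.
Proof.
rewrite big_imset/=; last by move=> ? ? _ _; exact: perm_inj.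
by under [RHS]eq_bigr do rewrite tnth_mktuple.
Qed.

Lemma forall_perm m (s : 'S_m) (J : {set 'I_m}) (p : R -> bool) (t : m.-tuple R) :
  [forall i in s @: J, p (tnth t i)] = [forall i in J, p (tnth (permt s t) i)].
Proof.
apply/forall_inP/forall_inP => pt i iJ.
  by rewrite tnth_mktuple; apply: pt; apply: imset_f.
by have /imsetP[j jJ ->] := iJ; have := pt j jJ; rewrite tnth_mktuple.
Qed.

Lemma above_perm m (s : 'S_m) (J : {set 'I_m}) (t : m.-tuple R) :
  above (s @: J) t = above J (permt s t).
Proof. by rewrite /above in_simplex_perm (forall_perm _ _ (fun y => 4 < y)). Qed.

Lemma excess_perm c m (s : 'S_m) (J : {set 'I_m}) (t : m.-tuple R) :
  excess c (s @: J) t = excess c J (permt s t).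
Proof.
by rewrite /excess in_simplex_perm (forall_perm _ _ (fun y => y <= 4)) sum_perm.
Qed.

Lemma double_excess_perm m (s : 'S_m) (J : {set 'I_m}) i (t : m.-tuple R) :
  double_excess (s @: J) (s i) t = double_excess J i (permt s t).
Proof.
have sJi : (s @: J :\ s i)%SET = (s @: (J :\ i))%SET.
  apply/setP => k; rewrite !inE; apply/andP/imsetP => [[ki /imsetP[l lJ kl]]|[l]].
    by exists l => //; rewrite !inE lJ andbT; apply: contraNneq ki => <-; rewrite kl.
  rewrite !inE => /andP[li lJ] ->; split; last exact: imset_f.
  by rewrite (inj_eq perm_inj).
by rewrite /double_excess excess_perm -sum_perm sJi.
Qed.

Lemma volume_perm m (s : 'S_m) (D E : m.-tuple R -> bool) :
  measurable_fun setT E -> (forall t, D t = E (permt s t)) ->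
  lebesgue_tuple [set t | D t] = lebesgue_tuple [set t | E t].
Proof.
move=> mE DE; rewrite -(lebesgue_tuple_perm s (measurable_boolset mE)).
by congr lebesgue_tuple; apply/funext => t /=; rewrite DE.
Qed.

Lemma card_first n k : (k <= n)%N -> #|first n k| = k.
Proof.
move=> kn; rewrite -sum1_card (eq_bigl (fun i : 'I_n => (i < k)%N)).
  by rewrite -(big_ord_widen n (fun=> 1%N) kn) sum_nat_const card_ord muln1.
by move=> i; rewrite inE.
Qed.

Lemma set_card_le m (J : {set 'I_m}) : (#|J| <= m)%N.
Proof. by rewrite -[leqRHS]card_ord max_card. Qed.

Lemma volume_above m (J : {set 'I_m}) : (#|J| = 1)%N ->
  lebesgue_tuple [set t : m.-tuple R | above J t] = (spow m 6)%:E.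
Proof.
move=> J1; have := set_card_le J; rewrite J1.
case: m J J1 => // n J J1 _.
have [s sJ] : exists s : 'S_n.+1, s @: first n.+1 1 = J.
  by apply: exists_perm_set; rewrite card_first.
rewrite -volume_above1; apply: (@volume_perm _ s); first exact: measurable_above.
by move=> t; rewrite -sJ above_perm.
Qed.

Lemma volume_above_pair m (J : {set 'I_m}) : (#|J| = 2)%N ->
  lebesgue_tuple [set t : m.-tuple R | above J t] = (spow m 2)%:E.
Proof.
move=> J2; have := set_card_le J; rewrite J2.
case: m J J2 => [|[|n]]// J J2 _.
have [s sJ] : exists s : 'S_n.+2, s @: first n.+2 2 = J.
  by apply: exists_perm_set; rewrite card_first.
rewrite -volume_above2; apply: (@volume_perm _ s); first exact: measurable_above.
by move=> t; rewrite -sJ above_perm.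
Qed.

(** In this volume and the next ones the predecessors of m are genuine: k indices
    can be chosen only if m >= k. *)
Lemma volume_excess_pair m (J : {set 'I_m}) : (#|J| = 2)%N ->
  lebesgue_tuple [set t : m.-tuple R | excess 7 J t] =
  (spow m.-1 3 - spow m 3 + spow m 2)%:E.
Proof.
move=> J2; have := set_card_le J; rewrite J2.
case: m J J2 => [|[|n]]// J J2 _.
have [s sJ] : exists s : 'S_n.+2, s @: first n.+2 2 = J.
  by apply: exists_perm_set; rewrite card_first.
rewrite -volume_excess2; apply: (@volume_perm _ s); first exact: measurable_excess.
by move=> t; rewrite -sJ excess_perm.
Qed.

Lemma volume_excess_triple m (J : {set 'I_m}) : (#|J| = 3)%N ->
  lebesgue_tuple [set t : m.-tuple R | excess 9 J t] =
  (9 / 2 * spow m.-2 1 - 3 * spow m.-1 1 + spow m 1)%:E.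
Proof.
move=> J3; have := set_card_le J; rewrite J3.
case: m J J3 => [|[|[|n]]]// J J3 _.
have [s sJ] : exists s : 'S_n.+3, s @: first n.+3 3 = J.
  by apply: exists_perm_set; rewrite card_first.
rewrite -volume_excess3; apply: (@volume_perm _ s); first exact: measurable_excess.
by move=> t; rewrite -sJ excess_perm.
Qed.

Lemma volume_double_excess_triple m (J : {set 'I_m}) i : (#|J| = 3)%N -> i \in J ->
  lebesgue_tuple [set t : m.-tuple R | double_excess J i t] =
  (1 / 2 * spow m.-2 1)%:E.
Proof.
move=> J3; have := set_card_le J; rewrite J3.
case: m J i J3 => [|[|[|n]]]// J i J3 _ iJ.
have j2 : (2 < n.+3)%N by [].
have [s sJ si] : exists2 s : 'S_n.+3, s @: first n.+3 3 = J & s (Ordinal j2) = i.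
  by apply: exists_perm_pointed => //; rewrite ?card_first// inE.
apply: etrans (volume_double_excess (i := Ordinal j2) erefl).
apply: (@volume_perm _ s); first exact: measurable_double_excess.
by move=> t; rewrite -sJ -si double_excess_perm.
Qed.

End symmetry.

(** * The inclusion-exclusion identity *)

Section decomposition.
Context {R : realType}.

Lemma cap4 : (cap 4 1 = 4)%N /\ (cap 4 2 = 7)%N /\ (cap 4 3 = 9)%N /\
  forall k, (4 <= k)%N -> (cap 4 k = 10)%N.
Proof.
split; first by rewrite /cap !big_ord_recl big_ord0.
split; first by rewrite /cap !big_ord_recl big_ord0.
split; first by rewrite /cap !big_ord_recl big_ord0.
move=> k k4; rewrite -(subnKC k4) /cap big_split_ord /= !big_ord_recl big_ord0.
by rewrite big1// => i _; rewrite subnDA subnn sub0n.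
Qed.

Definition in_polymatroid m (t : m.-tuple R) :=
  [forall i, 0 <= tnth t i] &&
  [forall J : {set 'I_m}, \sum_(i in J) tnth t i <= (cap 4 #|J|)%:R].

Lemma polymatroid_tuple m (t : m.-tuple R) :
  polymatroid 4 (\row_i tnth t i) <-> in_polymatroid t.
Proof.
split=> [[t0 tJ]|/andP[/forallP t0 /forallP tJ]].
  apply/andP; split; apply/forallP => i; first by have := t0 i; rewrite mxE.
  by have := tJ i; under eq_bigr do rewrite mxE.
split=> [i|J]; first by rewrite mxE.
by under eq_bigr do rewrite mxE.
Qed.

Lemma measurable_in_polymatroid m : measurable_fun setT (@in_polymatroid m).
Proof.
apply: measurable_and; apply: measurable_forall => i.
  by apply: measurable_fun_ler => //; exact: measurable_tnth.
by apply: measurable_fun_ler => //; exact: measurable_sum_tnth.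
Qed.

Lemma sum_subset m (c : R) (J K : {set 'I_m}) (t : m.-tuple R) :
  in_simplex c t -> (J \subset K)%SET ->
  \sum_(i in J) tnth t i <= \sum_(i in K) tnth t i.
Proof.
move=> /andP[/forallP t0 _] JK.
rewrite [leRHS](big_setID J)/= (finset.setIidPr JK) lerDl.
by apply: sumr_ge0 => i _; exact: t0.
Qed.

Lemma sum_le m (c : R) (J : {set 'I_m}) (t : m.-tuple R) :
  in_simplex c t -> \sum_(i in J) tnth t i <= c.
Proof.
move=> ts; apply: le_trans (sum_subset ts (finset.subsetT J)) _.
by move/andP: ts => [_]; apply: le_trans; rewrite le_eqVlt; apply/orP; left;
  apply/eqP/eq_bigl => i; rewrite inE.
Qed.

Lemma sum_notin m (c : R) (J : {set 'I_m}) i (t : m.-tuple R) :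
  in_simplex c t -> i \notin J -> tnth t i + \sum_(j in J) tnth t j <= c.
Proof. by move=> ts iJ; have := sum_le (i |: J)%SET ts; rewrite big_setU1. Qed.

Lemma in_polymatroid_simplex m (t : m.-tuple R) :
  in_polymatroid t -> in_simplex 10 t.
Proof.
move=> /andP[t0 /forallP tJ]; apply/andP; split=> //.
have := tJ [set: 'I_m]%SET; rewrite (eq_bigl xpredT) => [/le_trans|i]; last by rewrite inE.
apply; rewrite (ler_nat _ _ 10) /cap; have [c1 [c2 [c3 c4]]] := cap4.
case: (#|_|) => [|[|[|[|k]]]]; first by rewrite big_ord0.
- by rewrite [X in (X <= _)%N]c1.
- by rewrite [X in (X <= _)%N]c2.
- by rewrite [X in (X <= _)%N]c3.
- by rewrite [X in (X <= _)%N](c4 k.+4).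
Qed.

(** The other coordinates of J contribute at most 4 each. *)
Lemma excess_gt (c : R) m (J : {set 'I_m}) i (t : m.-tuple R) :
  excess c J t -> i \in J -> c - 4 * (#|J|.-1)%:R < tnth t i.
Proof.
move=> /and3P[ts /forall_inP t4 tJ] iJ.
move: tJ; rewrite (big_setD1 i)//= => tJ.
have : \sum_(j in J :\ i) tnth t j <= \sum_(j in J :\ i) 4.
  by apply: ler_sum => j; rewrite inE => /andP[_ /t4].
rewrite sumr_const (cardsD1 i J) iJ /= -[4 *+ _]mulr_natr; lra.
Qed.

(** An index of K outside J would carry more than 10 - c by the previous lemma,
    on top of a sum over J that exceeds c: too much for a total of 10. *)
Lemma excess_subset (c d : R) m (J K : {set 'I_m}) (t : m.-tuple R) :
  excess c J t -> excess d K t -> 10 <= c + (d - 4 * (#|K|.-1)%:R) ->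
  (K \subset J)%SET.
Proof.
move=> ecJ edK cd; apply/fintype.subsetP => i iK; apply: contraT => iJ.
have /and3P[ts _ tJ] := ecJ.
have := sum_notin ts iJ; have := excess_gt edK iK; lra.
Qed.

Lemma excess_pair_uniq m (J K : {set 'I_m}) (t : m.-tuple R) :
  #|J| == 2 -> #|K| == 2 -> excess 7 J t -> excess 7 K t -> J = K.
Proof.
move=> /eqP J2 /eqP K2 eJ eK; apply/esym/eqP; rewrite eqEcard J2 K2 leqnn andbT.
by apply: excess_subset eJ eK _; rewrite K2 /=; lra.
Qed.

Lemma excess_triple_uniq m (J K : {set 'I_m}) (t : m.-tuple R) :
  #|J| == 3 -> #|K| == 3 -> excess 9 J t -> excess 9 K t -> J = K.
Proof.
move=> /eqP J2 /eqP K2 eJ eK; apply/esym/eqP; rewrite eqEcard J2 K2 leqnn andbT.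
by apply: excess_subset eJ eK _; rewrite K2 /=; lra.
Qed.

Lemma sum_bool_uniq (I : finType) (P b : pred I) :
  (forall i j, P i -> P j -> b i -> b j -> i = j) ->
  (\sum_(i | P i) b i = [exists i, P i && b i])%N.
Proof.
move=> ub; case: existsP => [[i /andP[Pi bi]]|Nb].
  rewrite (bigD1 i)//= bi big1// => j /andP[Pj ji].
  by apply/eqP; rewrite eqb0; apply: contraNN ji => bj; apply/eqP/ub.
rewrite big1// => i Pi; apply/eqP; rewrite eqb0; apply/negP => bi.
by apply: Nb; exists i; rewrite Pi.
Qed.

Lemma sum_above m (t : m.-tuple R) k : in_simplex 10 t ->
  (\sum_(J : {set 'I_m} | #|J| == k) above J t = 'C(#|[set i | (4 < tnth t i)%R]%SET|, k))%N.
Proof.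
move=> ts; rewrite -cards_draws -sum1_card big_mkcond [RHS]big_mkcond/=.
apply: eq_bigr => J _; rewrite inE /above ts /= andbC.
suff -> : [forall i in J, 4 < tnth t i] = (J \subset [set i | (4 < tnth t i)%R]%SET).
  by case: eqP => //= _; case: (_ \subset _).
by apply/forall_inP/fintype.subsetP => tJ i /tJ; rewrite inE.
Qed.

Lemma card_above m (t : m.-tuple R) : in_simplex 10 t ->
  (#|[set i | (4 < tnth t i)%R]%SET| <= 2)%N.
Proof.
move=> ts; rewrite leqNgt; apply/negP => A3.
set A := finset _ in A3.
have := sum_le A ts; apply/negP; rewrite -ltNge.
have : \sum_(i in A) 4 <= \sum_(i in A) tnth t i.
  by apply: ler_sum => i; rewrite inE => /ltW.
apply: lt_le_trans; rewrite sumr_const -[_ *+ _]mulr_natr.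
have : (3 : R) <= #|A|%:R by rewrite (ler_nat _ 3).
lra.
Qed.

(** Sets of four or more indices impose nothing beyond the total sum, and
    singletons impose the bound 4. *)
Lemma in_polymatroidE m (t : m.-tuple R) : in_simplex 10 t ->
  (forall i, tnth t i <= 4) ->
  in_polymatroid t = ~~ [exists J : {set 'I_m}, (#|J| == 2) && excess 7 J t] &&
                     ~~ [exists J : {set 'I_m}, (#|J| == 3) && excess 9 J t].
Proof.
move=> ts t4; have [c1 [c2 [c3 c4]]] := cap4.
have exc c J : excess c J t = (c < \sum_(i in J) tnth t i).
  by rewrite /excess ts /=; apply: andb_idl => _; apply/forall_inP.
apply/idP/andP => [/andP[_ /forallP tJ]|[/existsPn N2 /existsPn N3]].
  split; apply/existsPn => J; apply/negP => /andP[/eqP cJ]; have := tJ J;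
    by rewrite exc cJ ?c2 ?c3 leNgt => /negP.
rewrite /in_polymatroid; have /andP[-> _] := ts; apply/forallP => J.
have := N2 J; have := N3 J; have := sum_le J ts; rewrite !exc.
case cJ : #|J| => [|[|[|[|k]]]] /=.
- by rewrite (cards0_eq cJ) big_set0.
- by move/eqP/cards1P: cJ => [i ->]; rewrite c1 big_set1.
- by rewrite c2 -leNgt.
- by rewrite c3 -leNgt.
- by rewrite c4.
Qed.

(** If a coordinate exceeds 4, no pair or triple with entries at most 4 is
    excessive, and the identity reads 1 + C(a, 2) = a where a is the number of
    coordinates above 4, which is 1 or 2. Otherwise let q and r in {0, 1} count
    the excessive pairs and triples: the point lies in the polymatroid iff
    q = r = 0, and the double excesses number q * r because an excessive pair
    lies inside any excessive triple. *)
Lemma decomposition m (t : m.-tuple R) :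
  (in_simplex 10 t + \sum_(J : {set 'I_m} | #|J| == 2) above J t
   + \sum_(J : {set 'I_m} | #|J| == 3) \sum_(i in J) double_excess J i t
   = in_polymatroid t + \sum_(J : {set 'I_m} | #|J| == 1) above J t
   + \sum_(J : {set 'I_m} | #|J| == 2) excess 7 J t
   + \sum_(J : {set 'I_m} | #|J| == 3) excess 9 J t)%N.
Proof.
have [ts|ts] := boolP (in_simplex 10 t); last first.
  have -> : in_polymatroid t = false.
    by apply: contraNF ts; exact: in_polymatroid_simplex.
  have above0 J : above J t = false by rewrite /above (negbTE ts).
  have excess0 c J : excess c J t = false by rewrite /excess (negbTE ts).
  rewrite !big1// => J _; rewrite ?above0 ?excess0//.
  by apply: big1 => i _; rewrite /double_excess excess0.
rewrite !sum_above//=.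
have [A0|[i]] := set_0Vmem [set i | (4 < tnth t i)%R]%SET; last first.
  rewrite inE => ti.
  have excess0 (c : R) J : 6 <= c -> excess c J t = false.
    move=> c6; apply/negP => /and3P[_ /forall_inP t4 tJ].
    have [/t4|iJ] := boolP (i \in J); first by rewrite leNgt ti.
    by have := sum_notin ts iJ; lra.
  have -> : in_polymatroid t = false.
    apply/negP => /andP[_ /forallP/(_ [set i]%SET)].
    by rewrite cards1 cap4.1 big_set1 leNgt ti.
  rewrite !big1//; last 3 first.
  - by move=> J _; rewrite excess0//; lra.
  - by move=> J _; rewrite excess0//; lra.
  - by move=> J _; apply: big1 => j _; rewrite /double_excess excess0//; lra.
  have : (0 < #|[set i | (4 < tnth t i)%R]%SET|)%N.
    by apply/card_gt0P; exists i; rewrite inE.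
  have := card_above ts.
  by case: (#|_|) => [|[|[|]]].
have t4 i : tnth t i <= 4.
  rewrite leNgt; apply/negP => ti.
  have : i \in [set i | (4 < tnth t i)%R]%SET by rewrite inE.
  by rewrite A0 inE.
have exc c J : excess c J t = (c < \sum_(i in J) tnth t i).
  by rewrite /excess ts /=; apply: andb_idl => _; apply/forall_inP.
rewrite A0 cards0 !bin0n/= !addn0.
rewrite in_polymatroidE// !sum_bool_uniq; last 2 first.
- by move=> J K; exact: excess_triple_uniq.
- by move=> J K; exact: excess_pair_uniq.
have [/existsP[J /andP[J3 eJ]]|/existsPn N3] :=
    boolP [exists J : {set 'I_m}, (#|J| == 3) && excess 9 J t]; last first.
  rewrite big1.
    by case: [exists _, _].
  move=> J J3; apply: big1 => i _; rewrite /double_excess.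
  by have := N3 J; rewrite J3 /= => /negbTE ->.
rewrite andbF add0n addnC; congr (_ + _)%N.
rewrite (bigD1 J)//= [X in (_ + X)%N]big1 ?addn0; last first.
  move=> K /andP[K3 KJ]; apply: big1 => i _; rewrite /double_excess.
  suff /negbTE -> : ~~ excess 9 K t by [].
  by apply: contraNN KJ => eK; apply/eqP; exact: (excess_triple_uniq K3 J3 eK eJ).
have cardJD i : i \in J -> #|J :\ i| == 2.
  by move=> iJ; move: J3; rewrite (cardsD1 i J) iJ.
rewrite (eq_bigr (fun i => nat_of_bool (excess 7 (J :\ i) t))); last first.
  by move=> i _; rewrite /double_excess eJ exc.
rewrite sum_bool_uniq; last first.
  move=> i j iJ jJ ei ej.
  have JJ := excess_pair_uniq (cardJD i iJ) (cardJD j jJ) ei ej.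
  apply/eqP/negPn/negP => ij; have : i \in J :\ j by rewrite !inE ij.
  by rewrite -JJ !inE eqxx.
congr nat_of_bool; apply/existsP/existsP => [[i /andP[iJ ei]]|[K /andP[K2 eK]]].
  by exists (J :\ i)%SET; rewrite cardJD.
have KJ : (K \subset J)%SET.
  by apply: excess_subset eJ eK _; rewrite (eqP K2) /=; lra.
have : (K \proper J)%SET by rewrite properEcard KJ (eqP K2) (eqP J3).
move=> /properP[_ [i iJ iK]]; exists i; rewrite iJ /=.
suff -> : (J :\ i)%SET = K by [].
apply/esym/eqP; rewrite eqEcard (eqP K2) (eqP (cardJD i iJ)) leqnn andbT.
by rewrite subsetD1 KJ.
Qed.

End decomposition.

(** * From counting identities to volumes *)

Section counting.
Context d (T : measurableType d) {R : realType} (mu : {measure set T -> \bar R}).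

(** Integrating sums of indicator functions with natural values, which allows
    integrating both sides of [decomposition] term by term. *)
Definition counts (f : T -> nat) (v : R) :=
  measurable_fun setT (fun t => (f t)%:R : R) /\
  (\int[mu]_t (f t)%:R%:E = v%:E)%E.

Lemma counts_bool (D : T -> bool) v : measurable_fun setT D ->
  mu [set t | D t] = v%:E -> counts (fun t => D t : nat) v.
Proof.
move=> mD Dv; have mD' := measurable_boolset mD.
have DE t : ((D t : nat)%:R : R) = \1_[set t | D t] t.
  by rewrite indicE; case: (boolP (D t)) => Dt; [rewrite mem_set|rewrite memNset//; exact/negP].
split; first by rewrite (funext DE); exact: measurable_indic.
by under eq_integral do rewrite DE; rewrite integral_indic// setIT.
Qed.

Lemma counts0 : counts (fun=> 0%N) 0.
Proof. by split; [exact: measurable_cst|rewrite integral0]. Qed.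

Lemma countsD f g u v : counts f u -> counts g v ->
  counts (fun t => f t + g t)%N (u + v).
Proof.
move=> [mf fu] [mg gv]; split.
  by under eq_fun do rewrite natrD; exact: measurable_funD.
under eq_integral do rewrite natrD EFinD.
rewrite ge0_integralD//; [by rewrite fu gv| |].
- exact/measurable_EFinP.
- exact/measurable_EFinP.
Qed.

Lemma counts_sum (I : finType) (P : pred I) (f : I -> T -> nat) (v : I -> R) :
  (forall i, P i -> counts (f i) (v i)) ->
  counts (fun t => \sum_(i | P i) f i t)%N (\sum_(i | P i) v i).
Proof.
move=> fv; rewrite unlock; elim: (index_enum I) => [|i r IH] /=.
  exact: counts0.
by case: ifP => // Pi; apply: countsD => //; exact: fv.
Qed.

Lemma counts_uniq f g u v : counts f u -> counts g v -> f =1 g -> u = v.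
Proof.
move=> [_ fu] [_ gv] fg; apply: EFin_inj; rewrite -fu -gv.
by apply: eq_integral => t _; rewrite fg.
Qed.

End counting.

Section volume_formula.
Context {R : realType}.

Lemma card_draws_ord m k : #|[pred J : {set 'I_m} | #|J| == k]| = 'C(m, k).
Proof. by rewrite -[m in RHS]card_ord -card_draws cardsE. Qed.

Lemma volume_polymatroid_eq m : exists2 v : R,
  lebesgue_tuple [set t : m.-tuple R | in_polymatroid t] = v%:E &
  spow m 10 + 'C(m, 2)%:R * spow m 2 +
    'C(m, 3)%:R * (3 * (1 / 2 * spow m.-2 1)) =
  v + m%:R * spow m 6 +
    'C(m, 2)%:R * (spow m.-1 3 - spow m 3 + spow m 2) +
    'C(m, 3)%:R * (9 / 2 * spow m.-2 1 - 3 * spow m.-1 1 + spow m 1).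
Proof.
set V := lebesgue_tuple _.
have Vfin : V \is a fin_num.
  rewrite ge0_fin_numE; last exact: measure_ge0.
  apply: (@le_lt_trans _ _ (spow m 10)%:E); last exact: ltry.
  rewrite -volume_simplex; apply: le_measure; rewrite ?inE.
  - exact: measurable_boolset (@measurable_in_polymatroid R m).
  - exact: measurable_boolset (@measurable_in_simplex R m 10).
  - by move=> t; exact: in_polymatroid_simplex.
exists (fine V); first by rewrite fineK.
have sumC k (c : R) : 'C(m, k)%:R * c = \sum_(J : {set 'I_m} | #|J| == k) c.
  by rewrite sumr_const card_draws_ord mulr_natl.
have -> : 'C(m, 3)%:R * (3 * (1 / 2 * spow m.-2 1) : R) =
    \sum_(J : {set 'I_m} | #|J| == 3) \sum_(i in J) (1 / 2 * spow m.-2 1).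
  by rewrite sumC; apply: eq_bigr => J /eqP J3; rewrite sumr_const J3 mulr_natl.
rewrite -[X in X%:R * spow m 6]bin1 !sumC.
apply: counts_uniq (@decomposition R m).
- apply: countsD; first apply: countsD.
  + by apply: counts_bool; [exact: measurable_in_simplex|exact: volume_simplex].
  + apply: counts_sum => J /eqP J2.
    by apply: counts_bool; [exact: measurable_above|exact: volume_above_pair].
  + apply: counts_sum => J /eqP J3; apply: counts_sum => i iJ.
    apply: counts_bool; first exact: measurable_double_excess.
    exact: volume_double_excess_triple.
- apply: countsD; first apply: countsD; first apply: countsD.
  + apply: counts_bool; first exact: measurable_in_polymatroid.
    by rewrite fineK.
  + apply: counts_sum => J /eqP J1.
    by apply: counts_bool; [exact: measurable_above|exact: volume_above].
  + apply: counts_sum => J /eqP J2.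
    by apply: counts_bool; [exact: measurable_excess|exact: volume_excess_pair].
  + apply: counts_sum => J /eqP J3.
    by apply: counts_bool; [exact: measurable_excess|exact: volume_excess_triple].
Qed.

End volume_formula.

(** * The formula *)

Theorem theorem5p13 (R : realType) (m : nat) (m_gt0 : (0 < m)%N) :
  normalized_volume R m 4 =
  (10 ^+ m - m%:R * 6 ^+ m
   - m%:R * (m%:R - 1) * (m%:R - 3) / 6 * 3 ^+ m
   - (3 * m%:R ^+ 2 - 6 * m%:R + 1) * 'C(m, 3)%:R)%:E.
Proof.
rewrite /normalized_volume /volume partial_permutohedronE.
have -> : [set t : m.-tuple R | polymatroid 4 (\row_i tnth t i)] =
    [set t | in_polymatroid t].
  by apply/seteqP; split=> t /polymatroid_tuple.
have [v -> vE] := @volume_polymatroid_eq R m.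
rewrite -EFinM; congr EFin.
case: m m_gt0 vE => // n _; rewrite [n.+1.-1]/=; set m := n.+1 => vE.
have fact0 k : k`!%:R != 0 :> R by rewrite pnatr_eq0 -lt0n fact_gt0.
have s0 c : 0 <= c -> m`!%:R * spow m c = c ^+ m :> R.
  by move=> c0; rewrite spowE// mulrC divfK.
have s1 c : 0 <= c -> m`!%:R * spow n c = m%:R * c ^+ n :> R.
  by move=> c0; rewrite spowE// /m factS natrM -mulrA mulrA mulrACA mulfV// mulr1.
(* m - 2 is truncated when m = 1, but then there are no triples *)
have s2 : m`!%:R * spow n.-1 1 * 'C(m, 3)%:R = m%:R * (m%:R - 1) * 'C(m, 3)%:R :> R.
  case: n @m {vE s0 s1} => [|k] m; first by rewrite bin_small// !mulr0.
  have -> : k.+2%:R - 1 = k.+1%:R :> R by rewrite -[k.+2%:R]natr1 addrK.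
  rewrite spowE// expr1n /m !factS !natrM [_.-1]/=.
  by field; exact: fact0.
have c2 : 'C(m, 2)%:R = m%:R * (m%:R - 1) / 2 :> R.
  have := mul_bin_diag m 1; rewrite bin1 => /(congr1 (fun k => k%:R : R)).
  have -> : m%:R - 1 = n%:R :> R by rewrite /m -natr1 addrK.
  by rewrite !natrM => ->; field.
have X3 : 3 ^+ m = 3 * 3 ^+ n :> R by rewrite exprS.
have -> : v = spow m 10 + 'C(m, 2)%:R * spow m 2 +
      'C(m, 3)%:R * (3 * (1 / 2 * spow n.-1 1)) - m%:R * spow m 6 -
      'C(m, 2)%:R * (spow n 3 - spow m 3 + spow m 2) -
      'C(m, 3)%:R * (9 / 2 * spow n.-1 1 - 3 * spow n 1 + spow m 1).
  by move: vE; lra.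
transitivity (m`!%:R * spow m (10 : R) + (m`!%:R * spow n.-1 1 * 'C(m, 3)%:R) * (3 / 2)
    - m%:R * (m`!%:R * spow m 6)
    - 'C(m, 2)%:R * (m`!%:R * spow n 3 - m`!%:R * spow m 3)
    - (9 / 2 * (m`!%:R * spow n.-1 1 * 'C(m, 3)%:R)
       - 'C(m, 3)%:R * 3 * (m`!%:R * spow n 1) + 'C(m, 3)%:R * (m`!%:R * spow m 1))).
  by field.
rewrite s2 !s0// !s1// !expr1n X3 c2.
by field.
Qed.
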